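(* For all integers $\alpha \geq 1$ and all integers $n \geq 0$, $$dp \left( 3^{2\alpha + 1}n + \frac{7 \cdot 9^\alpha + 1}{4} \right) \equiv 0 \pmod{3}.$$
   Context: A partition of a positive integer $n$ is a nonincreasing sequence of positive integers (called parts) whose sum is $n$. For $n\ge 0$, $dp(n)$ denotes the number of partitions of $n$ in which every part is either divisible by $4$ or congruent to $\pm 1 \pmod 6$ (with $dp(0)=1$). Equivalently, its generating function is $$\sum_{n=0}^{\infty} dp(n)q^n = \frac{1}{(q;q^6)_\infty (q^5;q^6)_\infty (q^4;q^4)_\infty},$$ where $(a;q)_\infty := (1-a)(1-aq)(1-aq^2)\cdots$. *)

(* Defs.v *)
From mathcomp Require Import all_boot.

Set Implicit Arguments.
Unset Strict Implicit.
Unset Printing Implicit Defensive.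

Definition is_partition (n : nat) (s : seq nat) : bool :=
  [&& sorted geq s, all (fun k => 0 < k) s & sumn s == n].

Definition dp_part (k : nat) : bool :=
  [|| 4 %| k, k == 1 %[mod 6] | k == 5 %[mod 6]].

Definition is_dp_partition (n : nat) (s : seq nat) : bool :=
  is_partition n s && all dp_part s.

(* A partition of n has at most n parts, each at most n, so the finite type
   {bseq n of 'I_n.+1} contains an exact copy of every partition of n;
   see dp_spec below. *)
Definition dp (n : nat) : nat :=
  #|[set s : {bseq n of 'I_n.+1} | is_dp_partition n (map val s)]|.

Lemma partition_bounds (n : nat) (s : seq nat) :
  is_partition n s -> size s <= n /\ all (fun k => k < n.+1) s.
Proof.
case/and3P=> _ + /eqP <-.
elim: s => [|k s IHs] //= /andP [k_gt0 /IHs [le_s all_s]]; split.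
  by rewrite -add1n leq_add.
rewrite ltnS leq_addr /=; apply: sub_all all_s => j.
by rewrite !ltnS => /leq_trans; apply; rewrite leq_addl.
Qed.

Lemma dp_spec (n : nat) (l : seq (seq nat)) :
  uniq l -> (forall s, (s \in l) = is_dp_partition n s) -> size l = dp n.
Proof.
move=> uniq_l mem_l; rewrite /dp cardE.
set e := enum _.
have inj : injective (fun s : {bseq n of 'I_n.+1} => map val s).
  by move=> s t /(inj_map val_inj) /val_inj.
rewrite -(size_map (fun s : {bseq n of 'I_n.+1} => map val s) e).
apply/perm_size/uniq_perm => //.
  by rewrite map_inj_uniq ?enum_uniq.
move=> s; rewrite mem_l; apply/idP/mapP => [dp_s | [t + ->]]; last first.
  by rewrite mem_enum inE.
have [/andP [/partition_bounds [le_s all_s] _]] := (dp_s, tt).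
pose u : seq 'I_n.+1 := map inord s.
have valu : map val u = s.
  rewrite -map_comp -[RHS]map_id; apply/eq_in_map => k /(allP all_s) lt_k /=.
  by rewrite inordK.
have size_u : size u <= n by rewrite size_map.
exists (Bseq size_u); last by rewrite /= valu.
by rewrite mem_enum inE /= valu.
Qed.

Lemma dp0 : dp 0 = 1.
Proof.
rewrite -(@dp_spec 0 [:: [::]]) // => -[|k s] //.
apply/esym/negP; case/andP=> /and3P [_ /= /andP [k_gt0 _]].
by rewrite addn_eq0 -leqn0 leqNgt k_gt0.
Qed.

(* Main.v *)
Require Import Defs.
From mathcomp Require Import all_boot all_algebra.
From mathcomp Require Import zify ring.

(* Let f(x,y) be the sum of x^(k(k+1)/2) y^(k(k-1)/2) over all integers k,
   psi(q) = f(q,q^3) and phi(q) = f(q,q).  By Jacobi's triple product the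
   generating function of dp(n)(-q)^n is psi(q^3) / (psi(q) (q^12;q^12)), which
   modulo 3 is psi(q)^2 / (q^12;q^12).  Since
   psi(q) = f(q^6,q^3) + q psi(q^9), the terms of degree 1 modulo 3 are
   2 q f(q^6,q^3) psi(q^9) / (q^12;q^12), and a product identity modulo 3 turns
   this into the congruence of dp(3n+1) with b(n), where b has the generating
   function psi(q)^2 phi(-q^6).  Splitting psi again gives psi(q^3)^2 phi(-q^2)
   for b(3n+2); as phi(-q^2) = phi(-q^18) + q^2 g(q^6) for some g, one gets
   b(9n+5) = 0 and b(9n+2) = b(n), that is, dp(27n+16) = 0 and
   dp(27n+7) = dp(3n+1) modulo 3.  The theorem follows by induction on alpha.

   Instead of formal power series we use an arbitrary commutative ring with an
   element x such that x^N = 0: all infinite sums and products become finite,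
   and their limits are exact equalities.  Coefficients are read off in
   F[X]/(X^N). *)

Set Implicit Arguments.
Unset Strict Implicit.
Unset Printing Implicit Defensive.

Import GRing.Theory.

(** * The generating function of dp *)

(* The fuel [k] only has to exceed [m + n]. *)
Fixpoint dp_list (k m n : nat) : seq (seq nat) :=
  match k, m with
  | 0, _ => [::]
  | _.+1, 0 => if n == 0 then [:: [::]] else [::]
  | k'.+1, m'.+1 =>
      dp_list k' m' n ++
      (if dp_part m && (m <= n) then map (cons m) (dp_list k' m (n - m))
       else [::])
  end.

Lemma dp_listS (k m n : nat) :
  dp_list k.+1 m.+1 n =
  dp_list k m n ++
  (if dp_part m.+1 && (m < n) then map (cons m.+1) (dp_list k m.+1 (n - m.+1))
   else [::]).
Proof. by []. Qed.

Lemma is_dp_partition_cons (n a : nat) (s : seq nat) :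
  is_dp_partition n (a :: s) =
  [&& 0 < a, dp_part a, a <= n, all (leq^~ a) s & is_dp_partition (n - a) s].
Proof.
rewrite /is_dp_partition /is_partition /= path_sortedE; last first.
  by move=> x y z /= yx zx; apply: leq_trans zx yx.
rewrite (_ : all (geq a) s = all (leq^~ a) s) //.
have -> : (a + sumn s == n) = (a <= n) && (sumn s == n - a) by lia.
rewrite -!andbA; case: (sorted _ _); case: (0 < a); case: (dp_part a);
  case: (a <= n); case: (all (leq^~ a) s); case: (all _ s) => //=;
  by rewrite ?andbF ?andbT //=; case: (_ == _); rewrite ?andbF.
Qed.

Lemma mem_dp_list (k m n : nat) (s : seq nat) : m + n < k ->
  (s \in dp_list k m n) = is_dp_partition n s && all (leq^~ m) s.
Proof.
elim: k m n s => // k IHk [|m] n s lt_mn.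
  case: s => [|a s] /=.
    rewrite /is_dp_partition /is_partition /= andbT eq_sym.
    by case: eqP; rewrite ?in_nil ?inE.
  rewrite is_dp_partition_cons leqn0; case: a => [|a] /=; rewrite ?andbF;
    by case: ifP.
rewrite dp_listS mem_cat IHk; last by lia.
case: s => [|a s].
  rewrite /= andbT; case: ifP => _; rewrite ?orbF //.
  by case: (is_dp_partition n _) => //=; apply/negP => /mapP [].
rewrite is_dp_partition_cons /=.
have [->|ne_a] := eqVneq a m.+1; last first.
  have -> : (a <= m.+1) = (a <= m) by lia.
  set r := if _ then _ else _; have -> : (a :: s \in r) = false.
    rewrite /r; case: ifP => // _; apply/negP => /mapP [t _ [eq_a]].
    by rewrite eq_a eqxx in ne_a.
  rewrite orbF; case: (leqP a m) => le_am; rewrite ?andbF //=.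
  case: (@idP (all (leq^~ a) s)) => [le_s|]; rewrite ?andbF //=.
  by rewrite !(sub_all _ le_s) // => b /= le_ba; lia.
rewrite ltnn andbF /= leqnn /=.
case: (@andP (dp_part m.+1) (m < n)) => [[dpm ltm]|h] /=; last first.
  rewrite in_nil; apply/esym/negP => /andP [/and4P [dpm ltm _ _] _].
  by case: h.
rewrite mem_map; last by move=> x y [].
rewrite IHk; last by lia.
by rewrite dpm ltm /= andbC; case: (all _ s) => //=; rewrite ?andbF ?andbT.
Qed.

Lemma uniq_dp_list (k m n : nat) : m + n < k -> uniq (dp_list k m n).
Proof.
elim: k m n => // k IHk [|m] n lt_mn; first by rewrite /=; case: eqP.
rewrite dp_listS cat_uniq IHk /=; last by lia.
case: ifP => //= /andP [_ le_mn].
rewrite map_inj_uniq ?IHk; [|by lia|by move=> x y []].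
rewrite andbT; apply/hasPn => _ /mapP [s _ ->].
rewrite mem_dp_list ?negb_and; last by lia.
by rewrite /= ltnn orbT.
Qed.

Definition dp_count (m n : nat) : nat := size (dp_list (m + n).+1 m n).

Lemma size_dp_list (k m n : nat) : m + n < k -> size (dp_list k m n) = dp_count m n.
Proof.
move=> lt_mn; apply/perm_size/uniq_perm; rewrite ?uniq_dp_list //.
by move=> s; rewrite !mem_dp_list.
Qed.

Lemma dp_count0 (n : nat) : dp_count 0 n = (n == 0).
Proof. by rewrite /dp_count /=; case: eqP. Qed.

Lemma dp_countS (m n : nat) :
  dp_count m.+1 n = dp_count m n +
    (if dp_part m.+1 && (m < n) then dp_count m.+1 (n - m.+1) else 0).
Proof.
rewrite {1}/dp_count dp_listS size_cat size_dp_list; last by lia.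
by case: ifP => // /andP [_ lt_mn]; rewrite size_map size_dp_list; lia.
Qed.

Lemma dp_count_dp (m n : nat) : n <= m -> dp_count m n = dp n.
Proof.
move=> le_nm; apply: dp_spec; first exact: uniq_dp_list.
move=> s; rewrite mem_dp_list //.
case: (boolP (is_dp_partition n s)) => //= /andP [/partition_bounds [_ le_s] _].
by apply: sub_all le_s => k; rewrite ltnS => /leq_trans; apply.
Qed.

Local Open Scope ring_scope.

Lemma expr_nil (R : comNzRingType) (q : R) (N n : nat) :
  q ^+ N = 0 -> (N <= n)%N -> q ^+ n = 0.
Proof. by move=> qN le_Nn; rewrite -(subnKC le_Nn) exprD qN mul0r. Qed.

(** Coefficients pushed past degree [N] meet [q ^+ N = 0], so multiplication by a power of [q] is an
    exact shift of the truncated series. *)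
Lemma sum_shift (R : comNzRingType) (q : R) (N : nat) (f : nat -> R) (k : nat) :
  q ^+ N = 0 ->
  \sum_(n < N) (if (k <= n)%N then f (n - k)%N else 0) * q ^+ n =
  q ^+ k * \sum_(n < N) f n * q ^+ n.
Proof.
case: N => [|N] qN; first by rewrite !big_ord0 mulr0.
elim: k => [|k IHk].
  by rewrite mul1r; apply: eq_bigr => n _; rewrite subn0.
rewrite exprS -mulrA -IHk big_ord_recl /= mul0r add0r.
rewrite [in RHS]big_ord_recr mulrDr /= mulrCA -exprS qN mulr0 addr0 mulr_sumr.
by apply: eq_bigr => n _; rewrite /bump /= add1n ltnS subSS exprS mulrCA.
Qed.

(** Induction on [m]: allowing the part m+1 turns the series G into G' with G' = G + q^(m+1) G',
    that is, G = G' (1 - q^(m+1)). *)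
Lemma dp_count_gf (R : comNzRingType) (q : R) (N m : nat) : q ^+ N = 0 ->
  (\sum_(n < N) (dp_count m n)%:R * q ^+ n) *
  \prod_(i < m | dp_part i.+1) (1 - q ^+ i.+1) = 1.
Proof.
move=> qN; elim: m => [|m IHm].
  (* For [N = 0] the hypothesis reads 1 = 0, which is excluded in a nonzero ring. *)
  case: N qN => [|N'] qN; first by move/eqP: qN; rewrite oner_eq0.
  rewrite big_ord0 mulr1 big_ord_recl dp_count0 big1 ?addr0 ?mulr1 // => i _.
  by rewrite dp_count0 mul0r.
set G := \sum_(n < N) _ in IHm; set G' := \sum_(n < N) _.
have EG' : G' = G + (if dp_part m.+1 then q ^+ m.+1 * G' else 0).
  rewrite {1}/G' /G; under eq_bigr => n _ do rewrite dp_countS natrD mulrDl.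
  rewrite big_split /=; congr (_ + _); case: ifP => _.
    rewrite -(sum_shift (fun n => (dp_count m.+1 n)%:R) _ qN).
    by apply: eq_bigr => n _; rewrite /=; case: (m < n)%N.
  by rewrite big1 // => n _; rewrite mul0r.
rewrite -[RHS]IHm big_mkcond big_ord_recr -big_mkcond /=.
case: ifP EG' => _ EG'; last by rewrite EG' addr0 mulr1.
suff -> : G = G' * (1 - q ^+ m.+1) by ring.
by apply: (addIr (q ^+ m.+1 * G')); rewrite -EG'; ring.
Qed.

Lemma dp_gf (R : comNzRingType) (q : R) (N : nat) : q ^+ N = 0 ->
  (\sum_(n < N) (dp n)%:R * q ^+ n) *
  \prod_(i < N | dp_part i.+1) (1 - q ^+ i.+1) = 1.
Proof.
move=> qN; rewrite -[RHS](dp_count_gf N qN); congr (_ * _).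
by apply: eq_bigr => n _; rewrite dp_count_dp ?(ltnW (ltn_ord n)).
Qed.

(** * Jacobi's triple product *)

(* Invertibility is stated by a witness because the ring need not carry a
   [unitRing] structure. *)
Definition invertible (R : comNzRingType) (a : R) : Prop := exists u, u * a = 1.

Lemma invertible_cancel (R : comNzRingType) (a b c : R) :
  invertible a -> a * b = a * c -> b = c.
Proof.
by case=> u ua eq_abc; rewrite -[b]mul1r -[c]mul1r -ua -!mulrA eq_abc.
Qed.

Lemma invertibleM (R : comNzRingType) (a b : R) :
  invertible a -> invertible b -> invertible (a * b).
Proof.
by case=> u ua [v vb]; exists (u * v); rewrite mulrACA ua vb mulr1.
Qed.

Lemma invertible_prod (R : comNzRingType) (n : nat) (P : pred 'I_n)
    (F : 'I_n -> R) :
  (forall i, invertible (F i)) -> invertible (\prod_(i < n | P i) F i).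
Proof.
move=> invF; apply: (big_ind (@invertible R)) => //.
  by exists 1; rewrite mulr1.
exact: invertibleM.
Qed.

Lemma geometric_inv (R : comNzRingType) (z : R) (N : nat) :
  z ^+ N = 0 -> (\sum_(j < N) z ^+ j) * (1 - z) = 1.
Proof.
move=> zN; have := subrX1 z N; rewrite zN sub0r => E.
by rewrite mulrC -[1 - z]opprB mulNr -E opprK.
Qed.

Lemma invertible_1B (R : comNzRingType) (z : R) (N : nat) :
  z ^+ N = 0 -> invertible (1 - z).
Proof. by move=> /geometric_inv; exists (\sum_(j < N) z ^+ j). Qed.

(** * The q-factorials $(p;p)_n$ and Gaussian binomial coefficients *)

Definition qpoch (R : comNzRingType) (p : R) (n : nat) : R :=
  \prod_(i < n) (1 - p ^+ i.+1).

Lemma qpochS (R : comNzRingType) (p : R) (n : nat) :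
  qpoch p n.+1 = qpoch p n * (1 - p ^+ n.+1).
Proof. by rewrite /qpoch big_ord_recr. Qed.

Lemma invertible_qpoch (R : comNzRingType) (p : R) (N n : nat) :
  p ^+ N = 0 -> invertible (qpoch p n).
Proof.
move=> pN; apply: invertible_prod => i; apply: (@invertible_1B _ _ N).
by rewrite -exprM mulnC exprM pN expr0n.
Qed.

(** Factors past [N] equal 1, so [qpoch p N] is the infinite product $(p;p)_\infty$. *)
Lemma qpoch_stable (R : comNzRingType) (p : R) (N n : nat) :
  p ^+ N = 0 -> (N <= n)%N -> qpoch p n = qpoch p N.
Proof.
move=> pN /subnKC <-; elim: (n - N)%N => [|k IHk]; first by rewrite addn0.
by rewrite addnS qpochS IHk (expr_nil pN) ?subr0 ?mulr1 //; lia.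
Qed.

(** Gaussian binomial coefficients, given by Pascal's rule to avoid division. *)
Fixpoint qbin (R : comNzRingType) (p : R) (n k : nat) : R :=
  match n, k with
  | _, 0 => 1
  | 0, _.+1 => 0
  | n'.+1, k'.+1 => qbin p n' k + p ^+ (n' - k') * qbin p n' k'
  end.

Arguments qbin : simpl never.

Lemma qbin0 (R : comNzRingType) (p : R) (n : nat) : qbin p n 0 = 1.
Proof. by case: n. Qed.

Lemma qbinS (R : comNzRingType) (p : R) (n k : nat) :
  qbin p n.+1 k.+1 = qbin p n k.+1 + p ^+ (n - k) * qbin p n k.
Proof. by []. Qed.

Lemma qbin_small (R : comNzRingType) (p : R) (n k : nat) :
  (n < k)%N -> qbin p n k = 0.
Proof.
elim: n k => [|n IHn] [|k] // lt_nk.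
by rewrite qbinS !IHn ?mulr0 ?addr0 //; lia.
Qed.

Lemma qbin_fact (R : comNzRingType) (p : R) (n k : nat) : (k <= n)%N ->
  qbin p n k * qpoch p k * qpoch p (n - k) = qpoch p n.
Proof.
have qpoch0 : qpoch p 0 = 1 by rewrite /qpoch big_ord0.
elim: n k => [|n IHn] [|k] // le_kn; rewrite ?subn0 ?qbin0 ?qpoch0 ?mul1r //.
rewrite qbinS subSS.
have [eq_kn|ne_kn] := eqVneq k n.
  have E := IHn n (leqnn n); rewrite subnn qpoch0 mulr1 in E.
  rewrite eq_kn subnn qpoch0 qbin_small // !qpochS.
  transitivity (qbin p n n * qpoch p n * (1 - p ^+ n.+1)); last by rewrite E.
  by rewrite expr0; ring.
have lt_kn : (k.+1 <= n)%N by lia.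
have [d En] : exists d, n = (k + d.+1)%N.
  by exists (n - k.+1)%N; lia.
have E1 := IHn k.+1 lt_kn; have E2 := IHn k (ltnW lt_kn).
have -> : (n - k = d.+1)%N by lia.
rewrite (_ : n - k.+1 = d)%N in E1; last by lia.
rewrite (_ : n - k = d.+1)%N in E2; last by lia.
have Ep : p ^+ n.+1 = p ^+ d.+1 * p ^+ k.+1 by rewrite -exprD; congr (_ ^+ _); lia.
(* Since n+1 = (d+1) + (k+1), the new factor 1 - p^(n+1) is (1 - p^(d+1)) + p^(d+1) (1 - p^(k+1)),
   one summand for each term of Pascal's rule. *)
transitivity (qpoch p n * (1 - p ^+ d.+1) +
              p ^+ d.+1 * (1 - p ^+ k.+1) * qpoch p n).
  by rewrite -{1}E1 -E2 !qpochS; ring.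
by rewrite qpochS Ep; ring.
Qed.

(** The recursion is not visibly symmetric, but [qbin_fact] is, and nilpotence of [p] lets the
    q-factorials be cancelled. *)
Lemma qbin_sym (R : comNzRingType) (p : R) (N n k : nat) : p ^+ N = 0 ->
  (k <= n)%N -> qbin p n k = qbin p n (n - k).
Proof.
move=> pN le_kn.
apply: (@invertible_cancel _ (qpoch p k * qpoch p (n - k))).
  by apply: invertibleM; apply: invertible_qpoch pN.
have E1 := qbin_fact p le_kn; have := qbin_fact p (leq_subr k n).
rewrite subKn // -E1 => E2.
by rewrite [LHS]mulrC mulrA -E2; ring.
Qed.

(* One factor of the finite Jacobi product: an induction along Pascal's rule. *)
Lemma qbin_sumS (R : comNzRingType) (p z : R) (th : nat -> R) (n : nat) :
  (forall k, (k <= n)%N -> z * th k = p ^+ (n - k) * th k.+1) ->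
  (\sum_(k < n.+1) qbin p n k * th k) * (1 + z) =
  \sum_(k < n.+2) qbin p n.+1 k * th k.
Proof.
move=> th_z; rewrite [RHS]big_ord_recl mulrDr mulr1 /= qbin0.
under [in RHS]eq_bigr => k _ do rewrite /bump /= add1n qbinS mulrDl.
rewrite big_split /= addrA; congr (_ + _).
  rewrite big_ord_recl /= qbin0; congr (_ + _).
  rewrite [RHS]big_ord_recr /= qbin_small // mul0r addr0.
  by apply: eq_bigr => k _; rewrite /bump /= add1n.
rewrite mulr_suml; apply: eq_bigr => k _.
by rewrite -mulrA [th k * z]mulrC th_z ?(ltnSE (ltn_ord k)) //; ring.
Qed.

(* The truncation of f(x,y); the second sum runs over the indices -(n+1). *)
Definition theta (R : comNzRingType) (K : nat) (x y : R) : R :=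
  \sum_(n < K) x ^+ 'C(n.+1, 2) * y ^+ 'C(n, 2) +
  \sum_(n < K) x ^+ 'C(n.+1, 2) * y ^+ 'C(n.+2, 2).

(* The term of index [k - l] of the bilateral theta series. *)
Definition theta_term (R : comNzRingType) (x y : R) (l k : nat) : R :=
  if (k < l)%N then y ^+ 'C((l - k).+1, 2) * x ^+ 'C(l - k, 2)
  else x ^+ 'C((k - l).+1, 2) * y ^+ 'C(k - l, 2).

Lemma leq_bin2S (n : nat) : (n <= 'C(n.+1, 2))%N.
Proof. by rewrite binS bin1 leq_addl. Qed.

Lemma bin2S (n : nat) : 'C(n.+1, 2) = ('C(n, 2) + n)%N.
Proof. by rewrite binS bin1. Qed.

(** Consecutive terms of the bilateral series have quotient $x(xy)^{k-l}$. This is the hypothesis of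
    [qbin_sumS] for the factor $1 + x(xy)^m$. *)
Lemma theta_termS (R : comNzRingType) (x y : R) (l m k : nat) :
  (k <= l + m)%N ->
  x * (x * y) ^+ m * theta_term x y l k =
  (x * y) ^+ (l + m - k) * theta_term x y l k.+1.
Proof.
move=> le_k; rewrite /theta_term; case: (ltnP k l) => [lt_kl|le_lk].
  have [d Ed] : exists d, (l - k = d.+1)%N by exists (l - k).-1; lia.
  have -> : (l + m - k = d + m.+1)%N by lia.
  rewrite Ed; case: ifP => [lt_kl'|ge_kl].
    have -> : (l - k.+1 = d)%N by lia.
    by rewrite !bin2S !exprMn !exprD !exprS; ring.
  have -> : d = 0%N by lia.
  have -> : (k.+1 - l = 0)%N by lia.
  by rewrite !bin2S /= !exprMn !exprD !exprS; ring.
have [d Ed] : exists d, (k - l = d)%N by exists (k - l)%N.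
rewrite ltnNge ltnW // subSn // Ed /=.
have Em : m = (d + (l + m - k))%N by lia.
by rewrite {1}Em !bin2S !exprMn !exprD !exprS; ring.
Qed.

Lemma jacobi_finite (R : comNzRingType) (x y : R) (N l m : nat) :
  (x * y) ^+ N = 0 ->
  (\prod_(i < l) (1 + y * (x * y) ^+ i)) * \prod_(i < m) (1 + x * (x * y) ^+ i) =
  \sum_(k < (l + m).+1) qbin (x * y) (l + m) k * theta_term x y l k.
Proof.
move=> pN; elim: m => [|m IHm]; last first.
  rewrite big_ord_recr /= mulrA IHm addnS; apply: qbin_sumS => k le_k.
  exact: theta_termS.
rewrite big_ord0 mulr1 addn0.
(* The factors in [y] are adjoined by the same induction with [x] and [y] exchanged; reversing the
   sum and the symmetry of [qbin] then restore the order of the terms. *)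
transitivity (\sum_(k < l.+1) qbin (x * y) l k * theta_term y x 0 k).
  elim: l => [|l IHl].
    by rewrite big_ord0 big_ord_recl big_ord0 /theta_term /= qbin0 !expr0; ring.
  rewrite big_ord_recr /= IHl; apply: qbin_sumS => k le_k.
  by rewrite [x * y]mulrC theta_termS.
rewrite (reindex_inj rev_ord_inj) /=; apply: eq_bigr => k _.
have le_kl : (k <= l)%N by rewrite -ltnS.
rewrite subSS -(qbin_sym pN) //; congr (_ * _).
rewrite /theta_term ltn0 subn0; case: ltnP => [_|le_lk].
  by [].
have -> : (k : nat) = l by lia.
by rewrite subnn !expr0.
Qed.

Lemma theta_stable (R : comNzRingType) (x y : R) (N K : nat) :
  x ^+ N = 0 -> (N <= K)%N -> theta K x y = theta N x y.
Proof.
move=> xN /subnKC <-; elim: (K - N)%N => [|k IHk]; first by rewrite addn0.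
rewrite addnS -IHk /theta !big_ord_recr /= (expr_nil xN) ?mul0r ?addr0 //.
by apply: leq_trans (leq_bin2S _); rewrite leq_addr.
Qed.

Definition theta_prod (R : comNzRingType) (K : nat) (x y : R) : R :=
  (\prod_(i < K) (1 + x * (x * y) ^+ i)) * (\prod_(i < K) (1 + y * (x * y) ^+ i)) *
  \prod_(i < K) (1 - (x * y) ^+ i.+1).

Lemma prod1D_stable (R : comNzRingType) (x p : R) (N K : nat) :
  p ^+ N = 0 -> (N <= K)%N ->
  \prod_(i < K) (1 + x * p ^+ i) = \prod_(i < N) (1 + x * p ^+ i).
Proof.
move=> pN /subnKC <-; elim: (K - N)%N => [|k IHk]; first by rewrite addn0.
rewrite addnS -IHk big_ord_recr /= (expr_nil pN) ?mulr0 ?addr0 ?mulr1 //.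
exact: leq_addr.
Qed.

Lemma jacobi_triple (R : comNzRingType) (x y : R) (N : nat) :
  x ^+ N = 0 -> y ^+ N = 0 -> theta N x y = theta_prod N x y.
Proof.
move=> xN yN; have pN : (x * y) ^+ N = 0 by rewrite exprMn xN mul0r.
(* The finite identity is used with 2N factors of each kind, so that every theta term that survives
   lies at distance at least N from both ends of the sum. *)
set M := (N + N)%N; have le_NM : (N <= M)%N by apply: leq_addr.
rewrite /theta_prod -!(@prod1D_stable _ _ (x * y) N M) //.
rewrite [X in _ = X * _]mulrC (jacobi_finite _ _ pN) -/(qpoch (x * y) N).
rewrite mulr_suml.
transitivity (\sum_(k < (M + M).+1) theta_term x y M k); last first.
  apply: eq_bigr => k _.
  have le_k : (k <= M + M)%N by rewrite -ltnS.
  (* In the middle range all three q-factorials of [qbin_fact] equal the infinite product, so the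
     binomial is its inverse. Outside it, the theta term carries a power of [x] or [y] of exponent
     at least N. *)
  have [/andP [lo hi]|out] := boolP ((N <= k)%N && (N <= M + M - k)%N).
    have := qbin_fact (x * y) le_k.
    rewrite !(@qpoch_stable _ (x * y) N) //;
      rewrite ?(leq_trans lo) ?(leq_trans le_NM) ?leq_addr //.
    set e := qpoch _ _; set b := qbin _ _ _ => Ebe.
    suff be1 : b * e = 1 by rewrite mulrAC be1 mul1r.
    apply: (@invertible_cancel _ e); first exact: invertible_qpoch pN.
    by rewrite mulr1 -[RHS]Ebe; ring.
  suff -> : theta_term x y M k = 0 by rewrite mulr0 mul0r.
  rewrite /theta_term; case: ltnP => ltkM.
    rewrite (expr_nil yN) ?mul0r //; apply: leq_trans (leq_bin2S _); lia.
  rewrite (expr_nil xN) ?mul0r //; apply: leq_trans (leq_bin2S _); lia.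
(* Indices below [M], reversed, form the negative half of the series; the others form the
   nonnegative half and one last term, which vanishes. *)
rewrite -(theta_stable y xN le_NM) -addnS big_split_ord /= addrC /theta.
symmetry; rewrite addrC [RHS]addrC.
congr (_ + _).
  rewrite (reindex_inj rev_ord_inj) /=; apply: eq_bigr => k _.
  have ltk := ltn_ord k.
  rewrite /theta_term ifT; last by lia.
  have -> : (M - (M - k.+1) = k.+1)%N by lia.
  by rewrite mulrC.
rewrite big_ord_recr /= [X in _ + X = _](_ : _ = 0) ?addr0.
  by apply: eq_bigr => k _; rewrite /theta_term ltnNge leq_addr /= addKn.
rewrite /theta_term ltnNge leq_addr /= addKn (expr_nil xN) ?mul0r //.
exact: leq_trans (leq_bin2S _).
Qed.

(** * Products over residue classes *)

Lemma big_ord_residues (T : Type) (idx : T) (op : Monoid.com_law idx)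
    (m K : nat) (F : nat -> T) :
  \big[op/idx]_(i < m * K) F i =
  \big[op/idx]_(s < m) \big[op/idx]_(i < K) F (m * i + s)%N.
Proof.
rewrite exchange_big /=; elim: K => [|K IHK]; first by rewrite muln0 !big_ord0.
by rewrite mulnSr big_split_ord /= IHK [RHS]big_ord_recr.
Qed.

(** Extending the product from N to mN factors only adds ones, so each residue class may keep the
    cutoff N. *)
Lemma prod_residues (R : comNzRingType) (m N : nat) (F : nat -> R) :
  (0 < m)%N -> (forall j, (N <= j)%N -> F j = 1) ->
  \prod_(i < N) F i = \prod_(s < m) \prod_(i < N) F (m * i + s)%N.
Proof.
move=> m_gt0 F1; rewrite -big_ord_residues.
have -> : (m * N = N + (m * N - N))%N by rewrite subnKC // leq_pmull.
rewrite big_split_ord /= [X in _ * X]big1 ?mulr1 // => i _.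
by rewrite F1 // leq_addr.
Qed.

(** In the usual notation $(-c x^r; x^b)_N$; the sign [c] is 1 or -1 in the applications. *)
Definition aprod (R : comNzRingType) (c x : R) (N b r : nat) : R :=
  \prod_(i < N) (1 + c * x ^+ (b * i + r)).

Lemma aprod_residues (R : comNzRingType) (c x : R) (N m b r : nat) :
  (0 < m)%N -> (0 < b)%N -> x ^+ N = 0 ->
  aprod c x N b r = \prod_(s < m) aprod c x N (b * m) (b * s + r).
Proof.
move=> m_gt0 b_gt0 xN.
rewrite /aprod (@prod_residues _ m N (fun i => 1 + c * x ^+ (b * i + r))) //.
  apply: eq_bigr => s _; apply: eq_bigr => i _; congr (1 + c * x ^+ _).
  by rewrite mulnDr mulnA addnA.
move=> j le_Nj; rewrite (expr_nil xN) ?mulr0 ?addr0 //.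
by apply: leq_trans le_Nj (leq_trans _ (leq_addr _ _)); rewrite leq_pmull.
Qed.

Lemma qpoch_aprod (R : comNzRingType) (x : R) (N b : nat) :
  qpoch (x ^+ b) N = aprod (-1) x N b b.
Proof. by apply: eq_bigr => i _; rewrite mulN1r -exprM mulnS addnC. Qed.

Lemma aprod_mul_qpoch (R : comNzRingType) (x : R) (N b : nat) :
  aprod 1 x N b b * qpoch (x ^+ b) N = qpoch (x ^+ (2 * b)) N.
Proof.
rewrite /aprod -big_split; apply: eq_bigr => i _ /=.
have -> : (x ^+ (2 * b)) ^+ i.+1 = (x ^+ b) ^+ i.+1 * (x ^+ b) ^+ i.+1.
  by rewrite -!exprM -exprD; congr (_ ^+ _); lia.
have -> : x ^+ (b * i + b) = (x ^+ b) ^+ i.+1 by rewrite -exprM mulnS addnC.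
by ring.
Qed.

Lemma theta_prod_aprod (R : comNzRingType) (c x : R) (N a b : nat) :
  c * c = 1 ->
  theta_prod N (c * x ^+ a) (c * x ^+ b) =
  aprod c x N (a + b) a * aprod c x N (a + b) b * qpoch (x ^+ (a + b)) N.
Proof.
move=> cc; have E : c * x ^+ a * (c * x ^+ b) = x ^+ (a + b).
  by rewrite exprD mulrACA cc mul1r.
rewrite /theta_prod E; congr (_ * _ * _); apply: eq_bigr => i _;
  by rewrite -exprM -mulrA -exprD addnC.
Qed.

Lemma rmorph_theta (R S : comNzRingType) (f : {rmorphism R -> S}) (K : nat)
    (x y : R) : f (theta K x y) = theta K (f x) (f y).
Proof.
rewrite /theta rmorphD !rmorph_sum; congr (_ + _); apply: eq_bigr => i _;
  by rewrite rmorphM !rmorphXn.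
Qed.

Lemma rmorph_qpoch (R S : comNzRingType) (f : {rmorphism R -> S}) (K : nat)
    (x : R) : f (qpoch x K) = qpoch (f x) K.
Proof.
by rewrite rmorph_prod; apply: eq_bigr => i _; rewrite rmorphB rmorph1 rmorphXn.
Qed.

(** Cubing is the Frobenius endomorphism, hence commutes with sums and products. *)
Lemma theta_pchar3 (R : comNzRingType) (K : nat) (x y : R) :
  3%N \in [pchar R] -> theta K (x ^+ 3) (y ^+ 3) = theta K x y ^+ 3.
Proof. by move=> ch; rewrite -!(pFrobenius_autE ch) rmorph_theta. Qed.

Lemma qpoch_pchar3 (R : comNzRingType) (K : nat) (x : R) :
  3%N \in [pchar R] -> qpoch (x ^+ 3) K = qpoch x K ^+ 3.
Proof. by move=> ch; rewrite -!(pFrobenius_autE ch) rmorph_qpoch. Qed.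

Lemma invertible_theta_prod (R : comNzRingType) (N : nat) (x y : R) :
  x ^+ N = 0 -> y ^+ N = 0 -> invertible (theta_prod N x y).
Proof.
move=> xN yN.
have inv z i : z ^+ N = 0 -> invertible (1 + z * (x * y) ^+ i).
  move=> zN; have zpN : (- (z * (x * y) ^+ i)) ^+ N = 0.
    by rewrite exprNn exprMn zN mul0r mulr0.
  by have := invertible_1B zpN; rewrite opprK.
apply: invertibleM; last first.
  by apply: invertible_qpoch (_ : _ ^+ N = 0); rewrite exprMn xN mul0r.
by apply: invertibleM; apply: invertible_prod => i; apply: inv.
Qed.

(** * Product identities for the generating function of [dp] *)

Lemma dp_part_period (i s : nat) : dp_part (12 * i + s) = dp_part s.
Proof. by rewrite /dp_part; lia. Qed.

(** The allowed residues modulo 12 are 1, 4, 5, 7, 8, 11 and 0; the sign of [- x] turns the factors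
    of odd parts into 1 + x^k. *)
Lemma dp_prod_aprod (R : comNzRingType) (x : R) (N : nat) : x ^+ N = 0 ->
  \prod_(i < N | dp_part i.+1) (1 - (- x) ^+ i.+1) =
  aprod 1 x N 12 1 * aprod (-1) x N 12 4 * aprod 1 x N 12 5 *
  aprod 1 x N 12 7 * aprod (-1) x N 12 8 * aprod 1 x N 12 11 *
  aprod (-1) x N 12 12.
Proof.
move=> xN; rewrite big_mkcond /=.
rewrite (@prod_residues _ 12 N
  (fun i => if dp_part i.+1 then 1 - (- x) ^+ i.+1 else 1)) //; last first.
  move=> j le_Nj; case: ifP => // _; rewrite exprNn (expr_nil xN).
    by rewrite mulr0 subr0.
  exact: leqW.
have E s : \prod_(i < N) (if dp_part (12 * i + s).+1
      then 1 - (- x) ^+ (12 * i + s).+1 else 1) =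
    if dp_part s.+1 then aprod (if odd s then -1 else 1) x N 12 s.+1 else 1.
  under eq_bigr => i _ do rewrite -addnS dp_part_period.
  case: ifP => _; last by rewrite big1.
  apply: eq_bigr => i _; rewrite exprNn -signr_odd oddD oddM /=.
  by case: (odd s); rewrite /= ?expr0 ?expr1; ring.
under eq_bigr => s _ do rewrite E.
by rewrite !big_ord_recr big_ord0 /=; ring.
Qed.

(* As [theta_prod N (x ^+ 9) (x ^+ 3)] is psi(x^3), this says that the sum of
   dp(n)(-x)^n is psi(x^3) / (psi(x) (x^12;x^12)). *)
Lemma dp_prod_psi (R : comNzRingType) (x : R) (N : nat) : x ^+ N = 0 ->
  \prod_(i < N | dp_part i.+1) (1 - (- x) ^+ i.+1) *
  theta_prod N (x ^+ 9) (x ^+ 3) =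
  theta_prod N (x ^+ 3) x * qpoch (x ^+ 12) N.
Proof.
move=> xN; rewrite dp_prod_aprod //.
have -> : theta_prod N (x ^+ 9) (x ^+ 3) =
    aprod 1 x N 12 9 * aprod 1 x N 12 3 * qpoch (x ^+ 12) N.
  by rewrite -(@theta_prod_aprod _ 1) ?mul1r.
have -> : theta_prod N (x ^+ 3) x =
    aprod 1 x N 4 3 * aprod 1 x N 4 1 * qpoch (x ^+ 4) N.
  by rewrite -(@theta_prod_aprod _ 1) ?mul1r ?expr1.
(* Once the modulus 4 is refined to 12, both sides consist of the same residue classes. *)
rewrite !qpoch_aprod (@aprod_residues _ 1 x N 3 4 3) //.
rewrite (@aprod_residues _ 1 x N 3 4 1) // (@aprod_residues _ (-1) x N 3 4 4) //.
by rewrite !big_ord_recr !big_ord0 /=; ring.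
Qed.

(* f(x^2,x) psi(x^3) = (x^4;x^4) psi(-x)^2 phi(-x^6), because modulo 3 both sides
   are (x;x)^2 (x^2;x^2)^4. *)
Lemma theta_relation (R : comNzRingType) (x : R) (N : nat) :
  3%N \in [pchar R] -> x ^+ N = 0 ->
  theta_prod N (x ^+ 2) x * theta_prod N (x ^+ 9) (x ^+ 3) =
  qpoch (x ^+ 4) N * theta_prod N ((- x) ^+ 3) (- x) ^+ 2 *
  theta_prod N (- x ^+ 6) (- x ^+ 6).
Proof.
move=> ch xN; have xkN k : (x ^+ k.+1) ^+ N = 0.
  by rewrite -exprM mulnC exprM xN expr0n.
have -> : theta_prod N (x ^+ 2) x =
    aprod 1 x N 3 2 * aprod 1 x N 3 1 * qpoch (x ^+ 3) N.
  by rewrite -(@theta_prod_aprod _ 1) ?mul1r ?expr1.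
have -> : theta_prod N (x ^+ 9) (x ^+ 3) =
    aprod 1 x N 12 9 * aprod 1 x N 12 3 * qpoch (x ^+ 12) N.
  by rewrite -(@theta_prod_aprod _ 1) ?mul1r.
have -> : theta_prod N ((- x) ^+ 3) (- x) =
    aprod (-1) x N 4 3 * aprod (-1) x N 4 1 * qpoch (x ^+ 4) N.
  rewrite -(@theta_prod_aprod _ (-1)) ?mulrNN ?mulr1 // !mulN1r expr1.
  by congr (theta_prod N _ _); ring.
have -> : theta_prod N (- x ^+ 6) (- x ^+ 6) =
    aprod (-1) x N 12 6 * aprod (-1) x N 12 6 * qpoch (x ^+ 12) N.
  by rewrite -(@theta_prod_aprod _ (-1)) ?mulrNN ?mulr1 // !mulN1r.
have odd1 : qpoch x N = aprod (-1) x N 4 3 * aprod (-1) x N 4 1 * qpoch (x ^+ 2) N.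
  rewrite -{1}[x]expr1 !qpoch_aprod (@aprod_residues _ (-1) x N 4 1 1) //.
  rewrite (@aprod_residues _ (-1) x N 2 2 2) //.
  by rewrite !big_ord_recr !big_ord0 /=; ring.
have odd6 : qpoch (x ^+ 6) N = aprod (-1) x N 12 6 * qpoch (x ^+ 12) N.
  rewrite !qpoch_aprod (@aprod_residues _ (-1) x N 2 6 6) //.
  by rewrite !big_ord_recr !big_ord0 /=; ring.
(* This is $(-x;x)_\infty (x;x)_\infty = (x^2;x^2)_\infty$ with the first product split by residues
   modulo 3, and the multiples of 3 split into odd ones and multiples of 6. *)
have all1 : aprod 1 x N 3 1 * aprod 1 x N 3 2 *
    (aprod 1 x N 12 3 * aprod 1 x N 12 9 * aprod 1 x N 6 6) * qpoch x N =
    qpoch (x ^+ 2) N.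
  rewrite -(aprod_mul_qpoch x N 1) (@aprod_residues _ 1 x N 3 1 1) //.
  rewrite !big_ord_recr !big_ord0 /= expr1 !mul1r; congr (_ * _ * _).
  rewrite [RHS](@aprod_residues _ 1 x N 4 3 3) //.
  rewrite (@aprod_residues _ 1 x N 2 6 6) //.
  by rewrite !big_ord_recr !big_ord0 /=; ring.
have even6 : aprod 1 x N 6 6 * qpoch (x ^+ 6) N = qpoch (x ^+ 12) N.
  exact: (aprod_mul_qpoch x N 6).
have e3 : qpoch (x ^+ 3) N = qpoch x N ^+ 3 by apply: qpoch_pchar3.
have e6 : qpoch (x ^+ 6) N = qpoch (x ^+ 2) N ^+ 3.
  by rewrite -qpoch_pchar3 // -exprM.
have e12 : qpoch (x ^+ 12) N = qpoch (x ^+ 4) N ^+ 3.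
  by rewrite -qpoch_pchar3 // -exprM.
have inv1 : invertible (qpoch x N) by apply: invertible_qpoch xN.
have inv2 : invertible (qpoch (x ^+ 2) N) by apply: invertible_qpoch (xkN 1).
have inv12 : invertible (qpoch (x ^+ 12) N) by apply: invertible_qpoch (xkN 11).
move: odd1 odd6 all1 even6 e3 e6 e12 inv1 inv2 inv12 => {xkN ch xN}.
move: (qpoch x N) (qpoch (x ^+ 2) N) (qpoch (x ^+ 3) N) (qpoch (x ^+ 4) N)
  (qpoch (x ^+ 6) N) (qpoch (x ^+ 12) N) => e1 e2 e3 e4 e6 e12.
move: (aprod 1 x N 3 1) (aprod 1 x N 3 2) (aprod 1 x N 12 3) (aprod 1 x N 12 9)
  (aprod 1 x N 6 6) (aprod (-1) x N 4 3) (aprod (-1) x N 4 1) (aprod (-1) x N 12 6).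
move=> a1 a2 b3 b9 c6 m3 m1 m6 odd1 odd6 all1 even6 E3 E6 E12 inv1 inv2 inv12.
transitivity (e1 ^+ 2 * e2 ^+ 4).
  (* The factor [e1], together with [e12 = c6 * e6], completes the left-hand product of [all1]. *)
  apply: (invertible_cancel inv1).
  transitivity (a1 * a2 * (b3 * b9 * c6) * e1 * (e3 * e6)).
    by rewrite -even6; ring.
  by rewrite all1 E3 E6; ring.
(* The factors [e2 * e2 * e12] complete the squares of [m3 * m1] and [m6] to those of [e1] and
   [e6]. *)
apply: (invertible_cancel (invertibleM (invertibleM inv2 inv2) inv12)).
transitivity ((m3 * m1 * e2) ^+ 2 * e4 ^+ 3 * (m6 * e12) ^+ 2); last by ring.
by rewrite -odd1 -odd6 E6 -E12; ring.
Qed.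

(** * Dissections modulo 3 *)

Definition triangular_sum (R : comNzRingType) (K : nat) (x : R) : R :=
  \sum_(j < K) x ^+ 'C(j.+1, 2).

Lemma double_bin2S (n : nat) : (2 * 'C(n.+1, 2) = n * n.+1)%N.
Proof. by rewrite -mul_bin_diag bin1 mulnC. Qed.

(** Even [j] give the nonnegative indices of the bilateral series psi, odd [j] the negative ones. *)
Lemma triangular_sum2 (R : comNzRingType) (K : nat) (x : R) :
  triangular_sum (2 * K) x = theta K (x ^+ 3) x.
Proof.
rewrite /triangular_sum (big_ord_residues _ 2 K (fun j => x ^+ 'C(j.+1, 2))).
rewrite !big_ord_recr big_ord0 /= add0r /theta.
congr (_ + _); apply: eq_bigr => n _; rewrite -exprM -exprD; congr (_ ^+ _).
  have := double_bin2S (2 * n + 0); rewrite bin2S; have := double_bin2S n.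
  by rewrite bin2S; nia.
have := double_bin2S (2 * n + 1); have := double_bin2S n.
by have := double_bin2S n.+1; nia.
Qed.

(** Residues 0 and 2 of [j] modulo 3 give the two halves of f(x^6,x^3); for j = 3n+1 the exponent is
    1 + 9n(n+1)/2. *)
Lemma triangular_sum3 (R : comNzRingType) (K : nat) (x : R) :
  triangular_sum (3 * K) x =
  theta K (x ^+ 6) (x ^+ 3) + x * triangular_sum K (x ^+ 9).
Proof.
rewrite /triangular_sum (big_ord_residues _ 3 K (fun j => x ^+ 'C(j.+1, 2))).
rewrite !big_ord_recr big_ord0 /= add0r /theta mulr_sumr addrAC.
congr (_ + _ + _); apply: eq_bigr => n _;
  rewrite -?exprM -?exprD -?exprS; congr (_ ^+ _).
- have := double_bin2S (3 * n + 0); rewrite bin2S; have := double_bin2S n.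
  by rewrite bin2S; nia.
- have := double_bin2S (3 * n + 2); have := double_bin2S n.
  by have := double_bin2S n.+1; nia.
- have := double_bin2S (3 * n + 1); have := double_bin2S n.
  by nia.
Qed.

Lemma psi_dissection (R : comNzRingType) (x : R) (N : nat) : x ^+ N = 0 ->
  theta N (x ^+ 3) x =
  theta N (x ^+ 6) (x ^+ 3) + x * theta N (x ^+ 27) (x ^+ 9).
Proof.
move=> xN; have xkN k : (x ^+ k.+1) ^+ N = 0.
  by rewrite -exprM mulnC exprM xN expr0n.
(* The cutoffs 3N and 2N make both sides sections of one triangular sum with 6N terms. *)
rewrite -(@theta_stable _ _ _ N (3 * N) (xkN 2)) ?leq_pmull //.
rewrite -(@theta_stable _ _ _ N (2 * N) (xkN 5)) ?leq_pmull //.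
by rewrite -triangular_sum2 mulnCA triangular_sum3 triangular_sum2 -exprM
  (theta_stable _ (xkN 26)) ?leq_pmull.
Qed.

(** The terms of phi(z) at indices prime to 3, divided by z and written in w = z^3: the exponents
    come from (3m+1)^2 and (3m+2)^2, the factor 2 from the sign of the index. *)
Definition phi_rest (R : comNzRingType) (K : nat) (w : R) : R :=
  (\sum_(m < K) (w ^+ (3 * m ^ 2 + 2 * m) + w ^+ (3 * m ^ 2 + 4 * m + 1))) *+ 2.

Lemma phi_dissection (R : comNzRingType) (z : R) (N : nat) : z ^+ N = 0 ->
  theta N z z = theta N (z ^+ 9) (z ^+ 9) + z * phi_rest N (z ^+ 3).
Proof.
move=> zN; rewrite -(@theta_stable _ _ _ N (3 * N) zN) ?leq_pmull //.
rewrite /theta (big_ord_residues _ 3 N (fun n => z ^+ 'C(n.+1, 2) * z ^+ 'C(n, 2))).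
rewrite (big_ord_residues _ 3 N (fun n => z ^+ 'C(n.+1, 2) * z ^+ 'C(n.+2, 2))).
rewrite !big_ord_recr !big_ord0 /= !add0r /phi_rest big_split /= mulrnAr mulrDr.
have sq n : ('C(n.+1, 2) + 'C(n, 2) = n ^ 2)%N.
  by have := double_bin2S n; rewrite bin2S; nia.
have -> : \sum_(i < N) z ^+ 'C((3 * i + 0).+1, 2) * z ^+ 'C(3 * i + 0, 2) =
    \sum_(n < N) (z ^+ 9) ^+ 'C(n.+1, 2) * (z ^+ 9) ^+ 'C(n, 2).
  by apply: eq_bigr => n _; rewrite -!exprD sq -exprM sq; congr (_ ^+ _); nia.
(* In the second sum n stands for the index -(n+1), so multiples of 3 come from the residue 2. *)
have -> : \sum_(i < N) z ^+ 'C((3 * i + 2).+1, 2) * z ^+ 'C((3 * i + 2).+2, 2) =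
    \sum_(n < N) (z ^+ 9) ^+ 'C(n.+1, 2) * (z ^+ 9) ^+ 'C(n.+2, 2).
  apply: eq_bigr => n _; rewrite -!exprD -exprM [in LHS]addnC [in RHS]addnC !sq.
  by congr (_ ^+ _); nia.
have r1 : \sum_(i < N) z ^+ 'C((3 * i + 1).+1, 2) * z ^+ 'C(3 * i + 1, 2) =
    z * \sum_(m < N) (z ^+ 3) ^+ (3 * m ^ 2 + 2 * m).
  rewrite mulr_sumr; apply: eq_bigr => n _.
  by rewrite -!exprD sq -exprM -exprS; congr (_ ^+ _); nia.
have r2 : \sum_(i < N) z ^+ 'C((3 * i + 2).+1, 2) * z ^+ 'C(3 * i + 2, 2) =
    z * \sum_(m < N) (z ^+ 3) ^+ (3 * m ^ 2 + 4 * m + 1).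
  rewrite mulr_sumr; apply: eq_bigr => n _.
  by rewrite -!exprD sq -exprM -exprS; congr (_ ^+ _); nia.
have -> : \sum_(i < N) z ^+ 'C((3 * i + 0).+1, 2) * z ^+ 'C((3 * i + 0).+2, 2) =
    z * \sum_(m < N) (z ^+ 3) ^+ (3 * m ^ 2 + 2 * m).
  rewrite -r1; apply: eq_bigr => n _; rewrite [RHS]mulrC.
  by rewrite addn0 addn1.
have -> : \sum_(i < N) z ^+ 'C((3 * i + 1).+1, 2) * z ^+ 'C((3 * i + 1).+2, 2) =
    z * \sum_(m < N) (z ^+ 3) ^+ (3 * m ^ 2 + 4 * m + 1).
  rewrite -r2; apply: eq_bigr => n _; rewrite [RHS]mulrC.
  by rewrite addn1 addn2.
by rewrite r1 r2; ring.
Qed.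

(** An explicit product of truncated geometric series, so that it also makes sense at a polynomial
    that is not nilpotent and is preserved by morphisms. *)
Definition qpoch_inv (R : comNzRingType) (p : R) (N : nat) : R :=
  \prod_(i < N) \sum_(j < N) (p ^+ i.+1) ^+ j.

Lemma qpoch_invP (R : comNzRingType) (p : R) (N : nat) :
  p ^+ N = 0 -> qpoch_inv p N * qpoch p N = 1.
Proof.
move=> pN; rewrite -big_split big1 //= => i _; apply: geometric_inv.
by rewrite -exprM mulnC exprM pN expr0n.
Qed.

Lemma rmorph_qpoch_inv (R S : comNzRingType) (f : {rmorphism R -> S}) (p : R)
    (N : nat) : f (qpoch_inv p N) = qpoch_inv (f p) N.
Proof.
rewrite rmorph_prod; apply: eq_bigr => i _; rewrite rmorph_sum.
by apply: eq_bigr => j _; rewrite !rmorphXn.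
Qed.

Lemma rmorph_phi_rest (R S : comNzRingType) (f : {rmorphism R -> S}) (K : nat)
    (w : R) : f (phi_rest K w) = phi_rest K (f w).
Proof.
rewrite rmorphMn rmorph_sum; congr (_ *+ _).
by apply: eq_bigr => i _; rewrite rmorphD !rmorphXn.
Qed.

Lemma dp_gf_dissection (R : comNzRingType) (x : R) (N : nat) :
  3%N \in [pchar R] -> x ^+ N = 0 ->
  \sum_(n < N) (dp n)%:R * x ^+ n =
  theta N ((- x ^+ 3) ^+ 2) (- x ^+ 3) ^+ 2 * qpoch_inv (x ^+ 12) N +
  x * (theta N ((x ^+ 3) ^+ 3) (x ^+ 3) ^+ 2 *
       theta N (- (x ^+ 3) ^+ 6) (- (x ^+ 3) ^+ 6)) +
  x ^+ 2 * (theta N ((- x ^+ 3) ^+ 9) ((- x ^+ 3) ^+ 3) ^+ 2 *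
            qpoch_inv (x ^+ 12) N).
Proof.
move=> ch xN; have := dp_gf xN; set G := \sum_(n < N) _; set D := \prod_(i < N | _) _.
have tN : (- x) ^+ N = 0 by rewrite exprNn xN mulr0.
have tkN k : ((- x) ^+ k.+1) ^+ N = 0.
  by rewrite -exprM mulnC exprM tN expr0n.
have x12N : (x ^+ 12) ^+ N = 0 by rewrite -exprM mulnC exprM xN expr0n.
have -> : D = \prod_(i < N | dp_part i.+1) (1 - (- (- x)) ^+ i.+1) by rewrite opprK.
have := dp_prod_psi tN; set D' := \prod_(i < N | _) _ => E1 GD.
(* With t = -x, the cube psi(t^3) = psi(t)^3 leaves G = psi(t)^2 / (t^12;t^12) after one factor
   psi(t) is cancelled. *)
have t3 : theta N ((- x) ^+ 9) ((- x) ^+ 3) = theta N ((- x) ^+ 3) (- x) ^+ 3.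
  by rewrite -theta_pchar3 // -exprM.
rewrite -!jacobi_triple ?(tkN 8) ?(tkN 2) // t3 in E1.
have E2 : qpoch ((- x) ^+ 12) N = D' * theta N ((- x) ^+ 3) (- x) ^+ 2.
  apply: (@invertible_cancel _ (theta N ((- x) ^+ 3) (- x))).
    by rewrite jacobi_triple ?(tkN 2) //; apply: invertible_theta_prod; rewrite ?(tkN 2).
  by rewrite -E1; ring.
have x12 : (- x) ^+ 12 = x ^+ 12 by ring.
have x3 : (- x) ^+ 3 = - x ^+ 3 by ring.
have EG : G = theta N ((- x) ^+ 3) (- x) ^+ 2 * qpoch_inv (x ^+ 12) N.
  rewrite -[G]mul1r -(qpoch_invP x12N) -x12 E2.
  transitivity (qpoch_inv ((- x) ^+ 12) N *
                theta N ((- x) ^+ 3) (- x) ^+ 2 * (G * D')); first by ring.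
  by rewrite GD; ring.
rewrite EG (psi_dissection tN).
have -> : theta N ((- x) ^+ 6) ((- x) ^+ 3) = theta N ((- x ^+ 3) ^+ 2) (- x ^+ 3).
  by rewrite -x3 -exprM.
have -> : theta N ((- x) ^+ 27) ((- x) ^+ 9) =
    theta N ((- x ^+ 3) ^+ 9) ((- x ^+ 3) ^+ 3).
  by rewrite -x3 -!exprM.
have x3N : (- x ^+ 3) ^+ N = 0 by rewrite -x3 tkN.
have ykN k : ((- x ^+ 3) ^+ k.+1) ^+ N = 0.
  by rewrite -exprM mulnC exprM x3N expr0n.
have zkN k : ((x ^+ 3) ^+ k.+1) ^+ N = 0.
  by rewrite -!exprM (expr_nil xN) //; nia.
have := theta_relation ch x3N.
have x6N : (- (- x ^+ 3) ^+ 6) ^+ N = 0 by rewrite exprNn (ykN 5) mulr0.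
rewrite -!jacobi_triple ?opprK ?(ykN 1) ?(ykN 8) ?(ykN 2) ?(zkN 2) ?(zkN 0) //.
have -> : (- x ^+ 3) ^+ 4 = x ^+ 12 by ring.
have -> : - (- x ^+ 3) ^+ 6 = - (x ^+ 3) ^+ 6 by ring.
have := qpoch_invP x12N.
have ch3 : 3%:R = 0 :> R by apply: pcharf0.
move: (theta N ((- x ^+ 3) ^+ 2) _) (theta N ((- x ^+ 3) ^+ 9) _).
move: (theta N ((x ^+ 3) ^+ 3) _) (theta N (- (x ^+ 3) ^+ 6) _).
move: (qpoch _ N) (qpoch_inv _ N) => f u psi phi A B uf AB.
(* The square of A - xB has middle term -2xAB, which is xAB modulo 3; [AB] then cancels the
   denominator. *)
transitivity (A ^+ 2 * u + x * (u * (A * B)) + x ^+ 2 * (B ^+ 2 * u) -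
              3%:R * x * (u * (A * B))).
  by ring.
rewrite ch3 AB !mul0r subr0; congr (_ + x * _ + _).
by transitivity (u * f * (psi ^+ 2 * phi)); [ring | rewrite uf mul1r].
Qed.

(* psi(x)^2 phi(-x^6) *)
Definition psi2phi (R : comNzRingType) (N : nat) (x : R) : R :=
  theta N (x ^+ 3) x ^+ 2 * theta N (- x ^+ 6) (- x ^+ 6).

(* psi(x^3)^2 phi(-x^2) *)
Definition psi2phi' (R : comNzRingType) (N : nat) (x : R) : R :=
  theta N (x ^+ 9) (x ^+ 3) ^+ 2 * theta N (- x ^+ 2) (- x ^+ 2).

Lemma psi2phi_dissection (R : comNzRingType) (x : R) (N : nat) : x ^+ N = 0 ->
  let y := x ^+ 3 in
  let phi := theta N (- y ^+ 2) (- y ^+ 2) in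
  psi2phi N x = theta N (y ^+ 2) y ^+ 2 * phi +
    x * (theta N (y ^+ 2) y * theta N (y ^+ 9) (y ^+ 3) * phi *+ 2) +
    x ^+ 2 * psi2phi' N y.
Proof.
move=> xN y phi; rewrite /psi2phi /psi2phi' psi_dissection //.
rewrite -/phi (_ : - x ^+ 6 = - y ^+ 2) -/phi /y -!exprM //.
by rewrite -[(3 * 2)%N]/6%N -[(3 * 9)%N]/27%N -[(3 * 3)%N]/9%N; ring.
Qed.

(** Only phi(-x^2) needs splitting, and its remainder sits in degree 2 modulo 3. The empty class of
    degree 1 is the source of the vanishing of dp(27n+16) modulo 3. *)
Lemma psi2phi'_dissection (R : comNzRingType) (x : R) (N : nat) : x ^+ N = 0 ->
  let y := x ^+ 3 in
  psi2phi' N x = psi2phi N y + x * 0 +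
    x ^+ 2 * (- theta N (y ^+ 3) y ^+ 2 * phi_rest N (- y ^+ 2)).
Proof.
move=> xN y; have x2N : (- x ^+ 2) ^+ N = 0.
  by rewrite exprNn -exprM mulnC exprM xN expr0n /= mulr0.
rewrite /psi2phi /psi2phi' (phi_dissection x2N).
have -> : (- x ^+ 2) ^+ 9 = - y ^+ 6 by rewrite /y; ring.
have -> : (- x ^+ 2) ^+ 3 = - y ^+ 2 by rewrite /y; ring.
have -> : x ^+ 9 = y ^+ 3 by rewrite /y; ring.
by rewrite -/y; ring.
Qed.

(** * Coefficients *)

Lemma coef_qpoly_eq (F : fieldType) (N : nat) (p p' : {poly F}) (i : nat) :
  in_qpoly 'X^N p = in_qpoly 'X^N p' -> (i < N)%N -> p`_i = p'`_i.
Proof.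
move=> eq_pp' lt_iN.
have coef_mod (q : {poly F}) : q`_i = (Pdiv.Ring.rmodp q 'X^N)`_i.
  rewrite {1}(Pdiv.RingMonic.rdivp_eq (monicXn F N) q) coefD coefMXn lt_iN.
  by rewrite add0r.
have := congr1 val eq_pp'; rewrite /= mk_monic_Xn prednK ?(leq_trans _ lt_iN) // => E.
by rewrite coef_mod E -coef_mod.
Qed.

Lemma qpolyX_expr (F : fieldType) (N : nat) :
  (0 < N)%N -> (in_qpoly 'X^N ('X : {poly F})) ^+ N = 0.
Proof.
move=> N_gt0; rewrite -rmorphXn /=; apply: val_inj.
by rewrite /= mk_monic_Xn prednK // Pdiv.RingMonic.rmodpp ?monicXn.
Qed.

Lemma coef_comp_dissection (F : fieldType) (N : nat) (p h0 h1 h2 : {poly F}) :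
  in_qpoly 'X^N p =
  in_qpoly 'X^N (h0 \Po 'X^3 + 'X * (h1 \Po 'X^3) + 'X^2 * (h2 \Po 'X^3)) ->
  forall k, [/\ (3 * k < N)%N -> p`_(3 * k) = h0`_k,
    (3 * k + 1 < N)%N -> p`_(3 * k + 1) = h1`_k &
    (3 * k + 2 < N)%N -> p`_(3 * k + 2) = h2`_k].
Proof.
move=> /coef_qpoly_eq E k; split=> ltN;
  rewrite E // !coefD coefXM coefXnM !coef_comp_poly_Xn //.
- case: k ltN => [|k] ltN; first by rewrite /= !addr0.
  have -> : (3 * k.+1 == 0)%N = false by lia.
  have -> : (3 * k.+1 < 2)%N = false by lia.
  have -> : (3 %| 3 * k.+1)%N by lia.
  have -> : (3 %| (3 * k.+1).-1)%N = false by lia.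
  have -> : (3 %| 3 * k.+1 - 2)%N = false by lia.
  by rewrite !addr0; congr (_`__); lia.
- have -> : (3 * k + 1 == 0)%N = false by lia.
  have -> : (3 %| 3 * k + 1)%N = false by lia.
  have -> : (3 %| (3 * k + 1).-1)%N by lia.
  case: ifP => [_|ge2].
    by rewrite add0r addr0; congr (_`__); lia.
  have -> : (3 %| 3 * k + 1 - 2)%N = false by lia.
  by rewrite add0r addr0; congr (_`__); lia.
have -> : (3 * k + 2 == 0)%N = false by lia.
have -> : (3 * k + 2 < 2)%N = false by lia.
have -> : (3 %| 3 * k + 2)%N = false by lia.
have -> : (3 %| (3 * k + 2).-1)%N = false by lia.
have -> : (3 %| 3 * k + 2 - 2)%N by lia.
by rewrite !add0r; congr (_`__); lia.
Qed.

(** Writes a series in x^3 as the image of a genuine polynomial, whose coefficients can be read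
    off. *)
Definition qpoly_cube (F : fieldType) (N : nat) :
    {rmorphism {poly F} -> {poly %/ ('X^N : {poly F})}} :=
  in_qpoly 'X^N \o comp_poly 'X^3.

Lemma qpoly_cubeX (F : fieldType) (N : nat) :
  qpoly_cube F N 'X = in_qpoly 'X^N 'X ^+ 3.
Proof. by rewrite /= comp_polyX rmorphXn. Qed.

Lemma coef_dissection (F : fieldType) (N : nat) (p h0 h1 h2 : {poly F}) :
  let x := in_qpoly 'X^N ('X : {poly F}) in
  in_qpoly 'X^N p = qpoly_cube F N h0 + x * qpoly_cube F N h1 +
    x ^+ 2 * qpoly_cube F N h2 ->
  forall k, [/\ (3 * k < N)%N -> p`_(3 * k) = h0`_k,
    (3 * k + 1 < N)%N -> p`_(3 * k + 1) = h1`_k &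
    (3 * k + 2 < N)%N -> p`_(3 * k + 2) = h2`_k].
Proof.
move=> x eq_p; apply: coef_comp_dissection.
by rewrite eq_p !(rmorphD, rmorphXn, rmorphM).
Qed.

Definition rmorph_thetaE :=
  (rmorph_theta, rmorph_qpoch_inv, rmorph_phi_rest,
   rmorphXn, rmorphM, rmorphMn, rmorphN).

Lemma dp_coef (F : fieldType) (N k : nat) : 3%N \in [pchar F] ->
  (3 * k + 1 < N)%N ->
  (dp (3 * k + 1))%:R = (psi2phi N ('X : {poly F}))`_k.
Proof.
move=> chF lt_kN; have N_gt0 : (0 < N)%N by lia.
pose p : {poly F} := \poly_(n < N) (dp n)%:R.
have xN := qpolyX_expr F N_gt0.
set x := in_qpoly _ _ in xN.
have ch : 3%N \in [pchar {poly %/ ('X^N : {poly F})}].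
  by rewrite pchar_qpoly.
have := dp_gf_dissection ch xN.
have -> : \sum_(n < N) (dp n)%:R * x ^+ n = in_qpoly 'X^N p.
  rewrite /p poly_def rmorph_sum; apply: eq_bigr => n _.
  by rewrite scaler_nat rmorphMn rmorphXn mulr_natl.
move=> Ep.
(* The components of [dp_gf_dissection] with 'X in place of x^3, so x^12 becomes 'X^4. *)
pose h0 : {poly F} := theta N ((- 'X) ^+ 2) (- 'X) ^+ 2 * qpoch_inv ('X ^+ 4) N.
pose h2 : {poly F} :=
  theta N ((- 'X) ^+ 9) ((- 'X) ^+ 3) ^+ 2 * qpoch_inv ('X ^+ 4) N.
have Eh : in_qpoly 'X^N p = qpoly_cube _ N h0 + x * qpoly_cube _ N (psi2phi N 'X) +
    x ^+ 2 * qpoly_cube _ N h2.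
  rewrite Ep /h0 /h2 /psi2phi !rmorph_thetaE.
  by rewrite !qpoly_cubeX -/x -!exprM.
have [_ <- // _] := coef_dissection Eh k.
by rewrite coef_poly lt_kN.
Qed.

Lemma psi2phi_coef (F : fieldType) (N k : nat) : (3 * k + 2 < N)%N ->
  (psi2phi N ('X : {poly F}))`_(3 * k + 2) = (psi2phi' N 'X)`_k.
Proof.
move=> lt_kN; have N_gt0 : (0 < N)%N by lia.
have xN := qpolyX_expr F N_gt0; set x := in_qpoly _ _ in xN.
pose phi : {poly F} := theta N (- 'X ^+ 2) (- 'X ^+ 2).
pose h0 : {poly F} := theta N ('X ^+ 2) 'X ^+ 2 * phi.
pose h1 : {poly F} := theta N ('X ^+ 2) 'X * theta N ('X ^+ 9) ('X ^+ 3) * phi *+ 2.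
have Eh : in_qpoly 'X^N (psi2phi N 'X) =
    qpoly_cube _ N h0 + x * qpoly_cube _ N h1 + x ^+ 2 * qpoly_cube _ N (psi2phi' N 'X).
  transitivity (psi2phi N x); first by rewrite /psi2phi !rmorph_thetaE.
  by rewrite (psi2phi_dissection xN) /h0 /h1 /phi /psi2phi' !rmorph_thetaE !qpoly_cubeX.
by have [_ _ <-] := coef_dissection Eh k.
Qed.

Lemma psi2phi'_coef (F : fieldType) (N k : nat) :
  ((3 * k < N)%N -> (psi2phi' N ('X : {poly F}))`_(3 * k)%N = (psi2phi N 'X)`_k)
  /\ ((3 * k + 1 < N)%N -> (psi2phi' N ('X : {poly F}))`_(3 * k + 1)%N = 0).
Proof.
have [-> //|N_gt0] := posnP N.
have xN := qpolyX_expr F N_gt0; set x := in_qpoly _ _ in xN.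
pose h2 : {poly F} := - theta N ('X ^+ 3) 'X ^+ 2 * phi_rest N (- 'X ^+ 2).
have Eh : in_qpoly 'X^N (psi2phi' N 'X) =
    qpoly_cube _ N (psi2phi N 'X) + x * qpoly_cube _ N 0 + x ^+ 2 * qpoly_cube _ N h2.
  transitivity (psi2phi' N x); first by rewrite /psi2phi' !rmorph_thetaE.
  by rewrite (psi2phi'_dissection xN) /h2 /psi2phi rmorph0 !rmorph_thetaE !qpoly_cubeX.
have [E0 E1 _] := coef_dissection Eh k.
by split=> // /E1 ->; rewrite coef0.
Qed.

(** * The congruences for [dp] modulo 3 *)

Lemma dp_27n16 (n : nat) : (dp (27 * n + 16))%:R = 0 :> 'F_3.
Proof.
(* The nested form shows the descent: [dp] to [psi2phi], then to [psi2phi'] at an index 3n+1, where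
   it vanishes. *)
have -> : (27 * n + 16 = 3 * (3 * (3 * n + 1) + 2) + 1)%N by lia.
rewrite (@dp_coef _ (27 * n + 17)) ?psi2phi_coef ?pchar_Fp //; [|lia..].
by apply: (psi2phi'_coef _ _ _).2; lia.
Qed.

Lemma dp_27n7 (n : nat) : (dp (27 * n + 7))%:R = (dp (3 * n + 1))%:R :> 'F_3.
Proof.
(* Here the descent reaches [psi2phi'] at 3n, which is [psi2phi] at n, hence dp(3n+1) again. *)
have -> : (27 * n + 7 = 3 * (3 * (3 * n) + 2) + 1)%N by lia.
rewrite !(@dp_coef _ (27 * n + 8)) ?psi2phi_coef ?pchar_Fp //; [|lia..].
by apply: (psi2phi'_coef _ _ _).1; lia.
Qed.

Local Close Scope ring_scope.

Theorem theorem1p6 (alpha n : nat) (halpha : 1 <= alpha) :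
  dp (3 ^ (2 * alpha + 1) * n + (7 * 9 ^ alpha + 1) %/ 4) = 0 %[mod 3].
Proof.
rewrite mod0n; apply/eqP; rewrite -/(3 %| _) (dvdn_pcharf (pchar_Fp (isT : prime 3))).
case: alpha halpha => // alpha _; apply/eqP.
have -> : 3 ^ (2 * alpha.+1 + 1) = 27 * 9 ^ alpha.
  have -> : 2 * alpha.+1 + 1 = 3 + 2 * alpha by lia.
  by rewrite expnD expnM.
elim: alpha => [|alpha IHalpha]; first exact: dp_27n16.
(* Writing the power of 9 as 8m+1 makes the division by 4 exact: (7 * 9^(alpha+1) + 1)/4 = 126m +
   16. *)
have [m Em] : exists m, 9 ^ alpha = 8 * m + 1.
  elim: alpha {IHalpha} => [|alpha [m Em]]; first by exists 0.
  by exists (9 * m + 1); rewrite expnS Em; lia.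
(* The argument is chosen so that 3k+1 is the index of the induction hypothesis; 27k+7 is then the
   next index. *)
have := dp_27n7 (9 * (9 ^ alpha * n) + 42 * m + 5).
rewrite (_ : 3 * _ + 1 = 27 * 9 ^ alpha * n + (7 * 9 ^ alpha.+1 + 1) %/ 4).
  by rewrite IHalpha => <-; congr (dp _)%:R%R; rewrite !expnS Em; lia.
by rewrite expnS Em; lia.
Qed.
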